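(* Let $p>0$ and let $m\ge 2$ be an even integer. Then the difference equation $$y_{n+1}=1+p\,\frac{y_{n-m}}{y_n^{2}},\qquad n=0,1,2,\dots,$$ has no positive two-periodic solution; that is, there do not exist positive real numbers $\alpha\neq\beta$ such that the sequence $\dots,\alpha,\beta,\alpha,\beta,\dots$ is a solution of the equation.
   Context: A positive solution is a sequence of positive real numbers $\{y_n\}_{n=-m}^{\infty}$ satisfying the recurrence for all $n\ge 0$. ''Two-periodic'' means of prime period two. *)

(* Defs.v *)
From HB Require Import structures.
From mathcomp Require Import all_boot all_order all_algebra.
From mathcomp Require Import reals.

Set Implicit Arguments.
Unset Strict Implicit.
Unset Printing Implicit Defensive.

Import Order.TTheory GRing.Theory Num.Theory.

Local Open Scope ring_scope.

(* A sequence {y_n}, n >= -m, is encoded as y : int -> R.  Every predicate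
   below reads y only at indices >= -m, so its other values are irrelevant. *)

Definition is_solution (R : realType) (p : R) (m : nat) (y : int -> R) : Prop :=
  forall n : nat,
    y (n%:Z + 1) = 1 + p * (y (n%:Z - m%:Z) / y n%:Z ^+ 2).

Definition positive_seq (R : realType) (m : nat) (y : int -> R) : Prop :=
  forall k : int, - m%:Z <= k -> 0 < y k.

Definition positive_solution (R : realType) (p : R) (m : nat)
    (y : int -> R) : Prop :=
  positive_seq m y /\ is_solution p m y.

Definition has_period (R : realType) (m : nat) (y : int -> R) (t : nat) : Prop :=
  (0 < t)%N /\ forall k : int, - m%:Z <= k -> y (k + t%:Z) = y k.

Definition has_prime_period (R : realType) (m : nat) (y : int -> R)
    (t : nat) : Prop :=
  has_period m y t /\ forall s : nat, has_period m y s -> (t <= s)%N.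

Definition two_periodic (R : realType) (m : nat) (y : int -> R) : Prop :=
  has_prime_period m y 2.

(* alpha at even indices, beta at odd ones. *)
Definition alternating (R : realType) (alpha beta : R) (k : int) : R :=
  if odd `|k|%N then beta else alpha.

(* Main.v *)
Require Import Defs.
From mathcomp Require Import all_boot all_order all_algebra.
From mathcomp Require Import reals.
From mathcomp Require Import ring zify.
Import Order.TTheory GRing.Theory Num.Theory.
Local Open Scope ring_scope.

(** Since [m] is even, [y (n - m) = y n] along a sequence of period two, so the
    recurrence collapses to the first-order one [y (n + 1) = 1 + p / y n].  Two
    alternating values [a], [b] then satisfy [b = 1 + p / a] and
    [a = 1 + p / b].  Clearing denominators gives [a + p = a * b = b + p], hence
    [a = b] ([reduced_two_cycle_trivial]).  So a solution of period two takes
    equal values at [0] and [1] ([period2_solution_eq01]).  For an abstract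
    sequence this forces period one, contradicting primality of the period two;
    for the alternating sequence the two values are [alpha] and [beta]
    themselves. *)

Lemma reduced_two_cycle_trivial (F : fieldType) (p a b : F) :
  a != 0 -> b != 0 ->
  b = 1 + p * (a / a ^+ 2) -> a = 1 + p * (b / b ^+ 2) -> a = b.
Proof.
move=> a0 b0 hb ha.
have hab : a * b = a + p by rewrite [in LHS]hb; field.
have hba : a * b = b + p by rewrite [in LHS]ha; field.
by apply: (addIr p); rewrite -hab hba.
Qed.

Lemma has_period2_double (R : realType) (m : nat) (y : int -> R) :
  has_period m y 2 ->
  forall (k : int) (i : nat), - m%:Z <= k -> y (k + i.*2%:Z) = y k.
Proof.
move=> [_ per] k i hk; elim: i => [|i IHi]; first by rewrite addr0.
have -> : k + i.+1.*2%:Z = k + i.*2%:Z + 2%:Z by lia.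
by rewrite per ?IHi //; lia.
Qed.

Lemma period2_solution_eq01 (R : realType) (p : R) (m : nat) (y : int -> R) :
  ~~ odd m -> is_solution p m y -> has_period m y 2 ->
  y 0 != 0 -> y 1 != 0 -> y 0 = y 1.
Proof.
move=> m_even sol per y0 y1.
have delay (n : nat) : y (n%:Z - m%:Z) = y n%:Z.
  rewrite -(has_period2_double _ _ _ per _ m./2); last by lia.
  by rewrite even_halfK // subrK.
have y2 : y (1%:Z + 1) = y 0 by rewrite -(per.2 0); last by lia.
apply: (reduced_two_cycle_trivial R p) => //.
- by have := sol 0%N; rewrite delay add0r.
- by have := sol 1%N; rewrite delay y2.
Qed.

(** Equality of two consecutive values propagates forward, as
    [y (k + 2) = y k = y (k + 1)]; it has to be started at the first index
    [- m], where it is inherited from [0] because [m] is even. *)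
Lemma period2_eq01_period1 (R : realType) (m : nat) (y : int -> R) :
  ~~ odd m -> has_period m y 2 -> y 0 = y 1 -> has_period m y 1.
Proof.
move=> m_even per y01; split=> // k hk.
have [j ->] : exists j : nat, k = - m%:Z + j%:Z.
  by exists `|(k + m%:Z)%R|%N; lia.
elim: j => [|j IHj].
  rewrite addr0 -(has_period2_double _ _ _ per (- m%:Z) m./2) //.
  rewrite -(has_period2_double _ _ _ per (- m%:Z + 1%:Z) m./2); last by lia.
  rewrite even_halfK // addNr y01; congr y; lia.
have -> : - m%:Z + j.+1%:Z + 1%:Z = - m%:Z + j%:Z + 2%:Z by lia.
have -> : - m%:Z + j.+1%:Z = - m%:Z + j%:Z + 1%:Z by lia.
by rewrite IHj per.2 //; lia.
Qed.

Lemma alternating_has_period2 (R : realType) (m : nat) (alpha beta : R) :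
  has_period m (alternating alpha beta) 2.
Proof.
split=> // k _; rewrite /alternating.
by have -> : odd `|(k + 2%:Z)%R|%N = odd `|k|%N by lia.
Qed.

Theorem theorem9 (R : realType) (p : R) (m : nat)
    (hp : 0 < p) (hm : (2 <= m)%N) (hm_even : ~~ odd m) :
  (~ exists y : int -> R, positive_solution p m y /\ two_periodic m y) /\
  (~ exists alpha beta : R,
      [/\ 0 < alpha, 0 < beta, alpha <> beta &
          is_solution p m (alternating alpha beta)]).
Proof.
split.
- case=> y [[pos sol] [per min_per]].
  have y01 : y 0 = y 1.
    by apply: (period2_solution_eq01 R p m) => //; apply: lt0r_neq0; apply: pos;
       lia.
  by have := min_per 1%N (period2_eq01_period1 _ _ _ hm_even per y01).
- case=> alpha [beta [alpha_gt0 beta_gt0 neq sol]]; apply: neq.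
  apply: (period2_solution_eq01 R p m (alternating alpha beta)) => //.
  + exact: alternating_has_period2.
  + exact: lt0r_neq0.
  + exact: lt0r_neq0.
Qed.
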